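(* Let $m,n\ge 2$ be integers and let $A$ be a nonconstant $m\times n$ matrix with complex entries. Then $$\mathcal{E}(A)\ge \sigma_1(A)+\frac{\operatorname{tr}(AA^{*})-\sigma_1^{2}(A)}{\sigma_2(A)}.$$
   Context: For a complex $m\times n$ matrix $A$, $A^{*}$ denotes its Hermitian adjoint (conjugate transpose) and $\operatorname{tr}$ denotes the trace. The singular values $\sigma_1(A)\ge\sigma_2(A)\ge\dots$ of $A$ are the square roots of the eigenvalues of $AA^{*}$ (counted with multiplicity). The energy of $A$ is $\mathcal{E}(A)=\sigma_1(A)+\sigma_2(A)+\cdots$, the sum of all singular values of $A$. A matrix is nonconstant if its entries are not all equal. *)

(* Defs.v *)
From mathcomp Require Export all_boot all_order all_algebra.
From mathcomp Require Export complex.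
From mathcomp Require Export reals.

Set Implicit Arguments.
Unset Strict Implicit.
Unset Printing Implicit Defensive.

Import Order.TTheory GRing.Theory Num.Theory.
Local Open Scope ring_scope.
Local Open Scope complex_scope.

Section Energy.
Variable R : realType.

(* [Num.conj] is complex conjugation on [R[i]], so this is the Hermitian adjoint. *)
Definition adjointmx m n (A : 'M[R[i]]_(m, n)) : 'M[R[i]]_(n, m) :=
  map_mx Num.conj (A^T).

(* The roots of the characteristic polynomial, repeated according to their
   multiplicity: [char_poly M = \prod_(z <- eigenvalues M) ('X - z%:P)]. *)
Definition eigenvalues n (M : 'M[R[i]]_n) : seq R[i] :=
  sval (closed_field_poly_normal (char_poly M)).

(* The order of [R[i]] is partial, [x <= y] meaning that [y - x] is a
   nonnegative real; it is total on the sequence sorted here, because the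
   eigenvalues of [A *m adjointmx A] are nonnegative reals, and so are their
   square roots [sqrtC]. *)
Definition singular_values m n (A : 'M[R[i]]_(m, n)) : seq R[i] :=
  sort >=%R [seq sqrtC z | z <- eigenvalues (A *m adjointmx A)].

(* Numbered from 1: [singular_value A 1] is the largest singular value. *)
Definition singular_value m n (A : 'M[R[i]]_(m, n)) (i : nat) : R[i] :=
  (singular_values A)`_i.-1.

Definition energy m n (A : 'M[R[i]]_(m, n)) : R[i] :=
  \sum_(s <- singular_values A) s.

Definition nonconstant m n (A : 'M[R[i]]_(m, n)) : Prop :=
  ~ (forall i j k l, A i j = A k l).

End Energy.

(* Main.v *)
Require Import Defs.
Import Order.TTheory GRing.Theory Num.Theory.
Local Open Scope ring_scope.
Local Open Scope complex_scope.

(** With the singular values listed in decreasing order as s1 >= s2 >= ..., the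
    trace of A A^* is the sum of their squares, so the numerator of the quotient
    is the sum of the s_i ^ 2 over i >= 2.  Since s_i <= s2 for these i, each
    s_i ^ 2 is at most s_i s2, and dividing by s2 leaves at most the sum of the
    s_i over i >= 2, which is the energy without s1.  When s2 = 0 the quotient
    is 0 and the bound says that the remaining singular values are nonnegative.

    Two facts make the list of singular values behave as expected: the trace is
    the sum of the eigenvalues ([mxtrace_eigenvalues]), and the eigenvalues of
    A A^* are nonnegative reals ([gram_eigenvalue_ge0]); the latter gives that
    sorting by the partial order of the complex numbers really yields a
    decreasing list ([singular_values_sorted]).  The inequality between the sums
    is then a statement on lists of numbers ([sum_ge_head_add_quotient]). *)

Section SortedSums.
Variable F : numFieldType.

Lemma sum_ge_head_add_quotient (s : seq F) :
    all (fun x => 0 <= x) s -> sorted >=%R s ->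
  s`_0 + (\sum_(x <- s) x ^+ 2 - s`_0 ^+ 2) / s`_1 <= \sum_(x <- s) x.
Proof.
case: s => [|a s] /=; first by rewrite !big_nil expr0n subrr mul0r addr0.
case/andP=> _ s_ge0 s_sorted; rewrite !big_cons (addrC (a ^+ 2)) addrK lerD2l.
case: s s_ge0 s_sorted => [|b t] s_ge0 s_sorted /=.
  by rewrite !big_nil mul0r.
have le_b : all (fun x => x <= b) (b :: t).
  rewrite /= lexx /=; case/andP: s_sorted => _ t_sorted.
  by apply: (order_path_min _ t_sorted) => x y z /= yx zy; apply: le_trans zy yx.
have b_ge0 : 0 <= b by case/andP: s_ge0.
have [b0|b_neq0] := eqVneq b 0.
  rewrite [X in _ / X <= _]b0 invr0 mulr0 big_seq sumr_ge0 // => x.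
  exact: (allP s_ge0).
have b_gt0 : 0 < b by rewrite lt_def b_neq0.
rewrite ler_pdivrMr // mulr_suml big_seq [leRHS]big_seq.
apply: ler_sum => x xs; rewrite expr2.
by rewrite ler_wpM2l ?(allP s_ge0 x xs) ?(allP le_b x xs).
Qed.

End SortedSums.

Section SingularValues.
Variable R : realType.

Lemma char_poly_eigenvalues n (M : 'M[R[i]]_n) :
  char_poly M = \prod_(z <- eigenvalues M) ('X - z%:P).
Proof.
rewrite /eigenvalues; case: closed_field_poly_normal => s /= defM.
by rewrite {1}defM (monicP (char_poly_monic M)) scale1r.
Qed.

(** Both sides are, up to sign, the subleading coefficient of the
    characteristic polynomial. *)
Lemma mxtrace_eigenvalues n (M : 'M[R[i]]_n) :
  \tr M = \sum_(z <- eigenvalues M) z.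
Proof.
have size_eig : size (eigenvalues M) = n.
  have := size_char_poly M; rewrite char_poly_eigenvalues.
  by rewrite size_prod_XsubC => -[].
case: n => [|n] in M size_eig *.
  by rewrite (size0nil size_eig) big_nil /mxtrace big_ord0.
apply: oppr_inj; rewrite -char_poly_trace // char_poly_eigenvalues.
by move: (eigenvalues M) size_eig => s ss; rewrite -[n.+1]ss coefPn_prod_XsubC ?ss.
Qed.

Lemma mul_adjointmx_ge0 n (v : 'rV[R[i]]_n) : 0 <= (v *m adjointmx v) 0 0.
Proof.
by rewrite mxE sumr_ge0 // => j _; rewrite !mxE mul_conjC_ge0.
Qed.

Lemma mul_adjointmx_gt0 n (v : 'rV[R[i]]_n) :
  v != 0 -> 0 < (v *m adjointmx v) 0 0.
Proof.
move=> v_neq0; rewrite lt_def mul_adjointmx_ge0 andbT.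
apply: contraNneq v_neq0; rewrite mxE => /psumr_eq0P v0.
apply/eqP/rowP => j; rewrite mxE; apply/eqP.
rewrite -mul_conjC_eq0; have := v0 _ j isT; rewrite !mxE => -> // k _.
by rewrite !mxE mul_conjC_ge0.
Qed.

Lemma adjointmxM m n p (A : 'M[R[i]]_(m, n)) (B : 'M_(n, p)) :
  adjointmx (A *m B) = adjointmx B *m adjointmx A.
Proof. by rewrite /adjointmx trmx_mul map_mxM. Qed.

(** If v is a left eigenvector for z, then z times the squared norm of v is
    v A A^* v^* , the squared norm of v A. *)
Lemma gram_eigenvalue_ge0 m n (A : 'M[R[i]]_(m, n)) z :
  z \in eigenvalues (A *m adjointmx A) -> 0 <= z.
Proof.
move=> z_eig.
have : root (char_poly (A *m adjointmx A)) z.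
  by rewrite char_poly_eigenvalues root_prod_XsubC.
rewrite -eigenvalue_root_char => /eigenvalueP[v vA v_neq0].
rewrite -(pmulr_lge0 _ (mul_adjointmx_gt0 _ _ v_neq0)).
have -> : z * (v *m adjointmx v) 0 0
        = ((v *m A) *m adjointmx (v *m A)) 0 0.
  by rewrite adjointmxM mulmxA -(mulmxA v) vA -scalemxAl [RHS]mxE.
exact: mul_adjointmx_ge0.
Qed.

Lemma singular_values_ge0 m n (A : 'M[R[i]]_(m, n)) :
  all (fun x => 0 <= x) (singular_values A).
Proof.
rewrite all_sort all_map; apply/allP => z z_eig /=.
by rewrite sqrtC_ge0 (gram_eigenvalue_ge0 _ _ _ _ z_eig).
Qed.

Lemma singular_values_sorted m n (A : 'M[R[i]]_(m, n)) :
  sorted >=%R (singular_values A).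
Proof.
have := singular_values_ge0 _ _ A; rewrite all_sort.
apply: sort_sorted_in => x y x_ge0 y_ge0.
by apply: real_leVge; apply: ger0_real.
Qed.

Lemma mxtrace_gram m n (A : 'M[R[i]]_(m, n)) :
  \tr (A *m adjointmx A) = \sum_(s <- singular_values A) s ^+ 2.
Proof.
rewrite mxtrace_eigenvalues (perm_big _ (permEl (perm_sort _ _))) big_map.
by apply: eq_bigr => z _; rewrite sqrtCK.
Qed.

End SingularValues.

(* When [singular_value A 2 = 0] (rank one), the quotient is read with the
   library convention [x / 0 = 0]. *)
Theorem mainTheorem3 (R : realType) (m n : nat) (hm : (2 <= m)%N)
    (hn : (2 <= n)%N) (A : 'M[R[i]]_(m, n)) (hA : nonconstant A) :
  energy A >= singular_value A 1
    + (\tr (A *m adjointmx A) - singular_value A 1 ^+ 2) / singular_value A 2.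
Proof.
rewrite mxtrace_gram; apply: sum_ge_head_add_quotient.
  exact: singular_values_ge0.
exact: singular_values_sorted.
Qed.
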